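(* Let $X$ be a Banach space of type $p$, $1<p\le 2$, with type constant $T_p(X)$, let $w=\frac{1-p}{p}$, and set $C(X)=2\,\frac{2^{1/p}}{1-2^{w}}\,T_p(X)$. Let $P\subset X$ with $|P|=n$ and $D=\operatorname{diam} P$, let $r\in[n]$ be an integer and let $\varepsilon>0$. Then there is a set $F\subset X$ of size at most $r^{r}\varepsilon^{-r}$ such that for every $Y\subset P$ with $|Y|\ge\varepsilon n$ $$\left(F+B\left(0,C(X)r^{w}D\right)\right)\cap\operatorname{conv} Y\neq\emptyset.$$
   Context: For a positive integer $m$, $[m]=\{1,\dots,m\}$. $B(x,\rho)=\{y\in X:\|y-x\|\le\rho\}$ is the closed ball, and $F+B$ denotes the Minkowski sum. A Banach space $X$ is of type $p$, for some $1<p\le 2$, if there is a constant $T_p(X)<\infty$ such that for every finite sequence of vectors $x_1,\dots,x_n\in X$, $$\int_0^1\Big\|\sum_{j=1}^n R_j(t)x_j\Big\|\,dt\le T_p(X)\Big(\sum_{j=1}^n\|x_j\|^p\Big)^{1/p},$$ where $\{R_j\}_{j\ge1}$ are the Rademacher functions. Thus the left-hand side is the average of $\|\sum_j \varepsilon_j x_j\|$ over all $2^n$ choices of signs $\varepsilon_j=\pm1$. $T_p(X)$ denotes the constant in this definition. *)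

(* Defs.v *)
From HB Require Import structures.
From mathcomp Require Import all_boot all_order all_algebra finmap.
From mathcomp Require Import all_classical all_reals all_analysis.

Set Implicit Arguments.
Unset Strict Implicit.
Unset Printing Implicit Defensive.
Import Order.TTheory GRing.Theory Num.Theory.
Import numFieldNormedType.Exports.

Local Open Scope classical_set_scope.
Local Open Scope ring_scope.

(* The Rademacher functions proper are the ones with j >= 1.  The value is 0 at
   the dyadic discontinuities, which form a null set. *)
Definition rademacher (R : realType) (j : nat) (t : R) : R :=
  Num.sg (sin (2 ^+ j * pi * t)).

(* The type-p inequality with constant [T].  No minimality of [T] is required:
   every admissible constant qualifies. *)
Definition type_constant (R : realType) (X : normedModType R) (p T : R) : Prop :=
  forall (n : nat) (x : 'I_n -> X),
    (\int[@lebesgue_measure R]_(t in `[0%R, 1%R])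
        (`| \sum_(j < n) rademacher j.+1 t *: x j |)%:E
     <= (T * (\sum_(j < n) `| x j | `^ p) `^ p^-1)%:E)%E.

Definition diam (R : realType) (X : normedModType R) (A : set X) : R :=
  sup [set `| x - y | | x in A & y in A].

Definition minkowski_sum (X : zmodType) (A B : set X) : set X :=
  [set x + y | x in A & y in B].

(* Unlike [closed_ball], [closed_ball_] is the ball [`|x - y| <= e] even when
   [e = 0]; the radius in the theorem vanishes when the diameter does. *)
Definition cball (R : realType) (X : normedModType R) (x : X) (e : R) : set X :=
  closed_ball_ (fun y : X => `| y |) x e.

Definition convex_hull (R : realType) (X : lmodType R) (A : set X) : set X :=
  smallest (@convex_set R X) A.

(* Main.v *)
(* Draw two independent uniform [r]-tuples [y], [z] in [Y].  The difference of
   their sums is symmetric, so its mean norm is unchanged by inserting signs, and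
   type [p] bounds it by [T D r^(1/p)].  By Markov some [z] has its average within
   [4 T D r^w <= C r^w D] of the average of at least half of the tuples [y] in
   [Y^r]; call these the good tuples of [Y].  A maximal family of sets [Y] with
   [|Y| >= eps n] whose sets of good tuples are pairwise disjoint has at most
   [n^r / ((eps n)^r / 2) = 2 eps^-r] members, and [F] consists of the averages of
   the corresponding [z]: any other [Y] shares a good tuple with a member of the
   family, and the average of that tuple lies in [conv Y].  Since [2 <= r^r] only
   for [r >= 2], the case [r = 1] uses a single point of [P]. *)
Require Import Defs.
From HB Require Import structures.
From mathcomp Require Import all_boot all_order all_algebra finmap.
From mathcomp Require Import all_classical all_reals all_analysis.
From mathcomp Require Import measurable_realfun zify ring lra.
Import Order.TTheory GRing.Theory Num.Theory.
Import numFieldNormedType.Exports.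
Local Open Scope classical_set_scope.
Local Open Scope ring_scope.

(** * Rademacher functions: signs almost everywhere, measurability *)

(** Removing the integer part of [x] changes the sine only by a sign, and the sine is positive
    strictly between 0 and [pi]. *)
Lemma sin_pi_eq0 (R : realType) (x : R) :
  0 <= x -> sin (pi * x) = 0 -> x = (Num.truncn x)%:R.
Proof.
move=> x0; have /andP[nx xn] := truncn_itv x0; set n := Num.truncn x in nx xn *.
have -> : pi * x = pi * (x - n%:R) + pi *+ n.
  by rewrite mulrBr mulr_natr subrK.
rewrite (alternatingn (@sinDpi R)) => /eqP.
rewrite mulf_eq0 signr_eq0 /= => /eqP sin0.
apply/eqP; move: nx; rewrite le_eqVlt eq_sym => /orP[//|nx].
suff : 0 < sin (pi * (x - n%:R)) by rewrite sin0 ltxx.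
apply: sin_gt0_pi; rewrite mulr_gt0 ?pi_gt0 ?subr_gt0//=.
by rewrite gtr_pMr ?pi_gt0// ltrBlDl natr1.
Qed.

(** The sines vanish on [0, 1] only at dyadic rationals, so one countable exceptional set serves all
    [j] at once. *)
Lemma ae_rademacher (R : realType) :
  {ae @lebesgue_measure R, forall t : R, `[0%R, 1%R]%classic t ->
    forall j, exists b : bool, rademacher j t = (-1) ^+ b}.
Proof.
pose N : set R := range (fun u : nat * nat => u.2%:R / 2 ^+ u.1).
have cN : countable N by apply: sub_countable (card_image_le _ _) _; exact: countableP.
exists N; split.
- exact: countable_measurable.
- exact: countable_lebesgue_measure0.
- move=> t /= /not_implyP[t01 /existsNP[j jt]].
  move: t01; rewrite in_itv /= => /andP[t0 _].
  exists (j, Num.truncn (2 ^+ j * t)) => //=.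
  suff /sin_pi_eq0 <- : sin (pi * (2 ^+ j * t)) = 0.
  + by rewrite mulrAC mulfV ?mul1r// expf_neq0.
  + by rewrite mulr_ge0 ?exprn_ge0.
  apply: contrapT => /eqP sn0; apply: jt.
  exists (sin (pi * (2 ^+ j * t)) < 0).
  have -> : rademacher j t = Num.sg (sin (pi * (2 ^+ j * t))).
    by rewrite /rademacher mulrA [pi * _]mulrC.
  by rewrite sgr_def sn0 mulr1n.
Qed.

Lemma measurable_rademacher (R : realType) (j : nat) :
  measurable_fun [set: R] (rademacher j).
Proof.
have ms : measurable_fun [set: R] (fun t => sin (2 ^+ j * pi * t)).
  apply: continuous_measurable_fun => t.
  apply: continuous_comp; last exact: continuous_sin.
  exact: mulrl_continuous.
rewrite [rademacher _](_ : _ = fun t =>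
    if sin (2 ^+ j * pi * t) == 0 then 0 else
    if sin (2 ^+ j * pi * t) < 0 then -1 else 1) //.
apply: measurable_fun_ifT => //; first exact: measurable_fun_eqr.
apply: measurable_fun_ifT => //; exact: measurable_fun_ltr.
Qed.

(** No sigma-algebra on [X] is involved: the norm is split over the three values of one Rademacher
    function at a time, and [v] collects the terms already decided. *)
Lemma measurable_norm_rademacher_sum (R : realType) (X : normedModType R)
    (I : Type) (s : seq I) (j : I -> nat) (x : I -> X) (v : X) :
  measurable_fun [set: R] (fun t => `|v + \sum_(i <- s) rademacher (j i) t *: x i|).
Proof.
elim: s v => [|i s IHs] v.
  by under eq_fun do rewrite big_nil; exact: measurable_cst.
rewrite [X in measurable_fun _ X](_ : _ = fun t =>
    if rademacher (j i) t == 1 then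
      `|(v + x i) + \sum_(i <- s) rademacher (j i) t *: x i|
    else if rademacher (j i) t == -1 then
      `|(v - x i) + \sum_(i <- s) rademacher (j i) t *: x i|
    else `|v + \sum_(i <- s) rademacher (j i) t *: x i|).
  apply: measurable_fun_ifT => //.
    by apply: measurable_fun_eqr => //; exact: measurable_rademacher.
  apply: measurable_fun_ifT => //.
  by apply: measurable_fun_eqr => //; exact: measurable_rademacher.
apply/funext => t; rewrite big_cons addrA /rademacher sgr_def.
case: (sin _ == 0); last case: (sin _ < 0); rewrite /= ?mulr1n ?mulr0n ?expr1 ?expr0.
- by rewrite scale0r addr0 eq_sym oner_eq0 eq_sym oppr_eq0 oner_eq0.
- by rewrite eqNr oner_eq0 eqxx scaleN1r.
- by rewrite eqxx scale1r.
Qed.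

(** * Symmetrization and the type inequality *)

(** Exchanging the two tuples at the coordinates where [s j] holds is an involution on pairs of
    tuples in [A], and it negates exactly those differences. *)
Lemma sum_norm_sign_swap (R : realType) (X : normedModType R) (I : finType)
    (f : I -> X) (A : {set I}) (r : nat) (s : 'I_r -> bool) :
  \sum_(q : {ffun 'I_r -> I} * {ffun 'I_r -> I} |
       (q.1 \in ffun_on A) && (q.2 \in ffun_on A))
     `|\sum_(j < r) (-1) ^+ s j *: (f (q.1 j) - f (q.2 j))| =
  \sum_(q : {ffun 'I_r -> I} * {ffun 'I_r -> I} |
       (q.1 \in ffun_on A) && (q.2 \in ffun_on A))
     `|\sum_(j < r) (f (q.1 j) - f (q.2 j))|.
Proof.
pose sw (q : {ffun 'I_r -> I} * {ffun 'I_r -> I}) :=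
  ([ffun j => if s j then q.2 j else q.1 j],
   [ffun j => if s j then q.1 j else q.2 j]).
have swK : involutive sw.
  move=> [y z]; congr pair; apply/ffunP => j; rewrite !ffunE /=;
  by case sj: (s j); rewrite ?ffunE ?sj.
have swS q : (q.1 \in ffun_on A) && (q.2 \in ffun_on A) ->
    ((sw q).1 \in ffun_on A) && ((sw q).2 \in ffun_on A).
  move=> /andP[/ffun_onP q1 /ffun_onP q2].
  by apply/andP; split; apply/ffun_onP => j; rewrite ffunE; case: (s j).
rewrite [RHS](reindex_inj (inv_inj swK)) /=.
apply: eq_big => [q|q _].
  by apply/idP/idP => qS; [exact: swS|have := swS (sw q) qS; rewrite swK].
congr (`| _ |); apply: eq_bigr => j _; rewrite !ffunE.
by case: (s j); rewrite ?expr1 ?expr0 ?scaleN1r ?scale1r ?opprB.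
Qed.

(* Almost every [t] turns [rademacher j.+1 t] into a choice of signs, so a sum
   of norms that does not depend on the signs equals its integral over [t]. *)
Lemma type_constant_sign_invariant (R : realType) (X : normedModType R)
    (p T : R) (J : finType) (Q : pred J) (r : nat) (x : J -> 'I_r -> X) (K : R) :
  type_constant X p T ->
  (forall s : 'I_r -> bool,
     \sum_(q | Q q) `|\sum_(j < r) (-1) ^+ s j *: x q j| = K) ->
  K <= \sum_(q | Q q) T * (\sum_(j < r) `|x q j| `^ p) `^ p^-1.
Proof.
move=> hT xK.
pose g (q : J) (t : R) : \bar R :=
  (`|\sum_(j < r) rademacher j.+1 t *: x q j|)%:E.
have mg q : measurable_fun (`[0%R, 1%R]%classic : set R) (g q).
  apply: measurable_funTS; apply/measurable_EFinP.
  have := @measurable_norm_rademacher_sum R X _ (index_enum 'I_r)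
    (fun j => (val j).+1) (x q) 0.
  by under eq_fun do rewrite add0r.
have g0 q t : (0 <= g q t)%E by rewrite lee_fin.
have K0 : 0 <= K by rewrite -(xK (fun=> false)) sumr_ge0.
(* The unit interval has measure 1, so [K] is the integral of a constant that agrees almost
   everywhere with the sum of the [g q]. *)
have Kint : (K%:E = \int[@lebesgue_measure R]_(t in `[0%R, 1%R])
    (\sum_(q <- enum Q) g q t))%E.
  transitivity (\int[@lebesgue_measure R]_(t in `[0%R, 1%R]) (cst K%:E t))%E.
    rewrite integral_cst//= lebesgue_measure_itv/= lte01 oppr0 adde0.
    by rewrite mule1.
  apply: ge0_ae_eq_integral => //.
  - exact: emeasurable_sum.
  - by move=> t _; rewrite sume_ge0.
  have [N [mN N0 subN]] := ae_rademacher R; exists N; split=> // t /= Kt.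
  apply: subN => rt; apply: Kt => t01; move: (rt t01) => {}rt.
  pose s (j : 'I_r) := projT1 (cid (rt j.+1)).
  rewrite big_enum_cond /= -(xK s) sumEFin.
  congr (_%:E); apply: eq_big => [q|q _]; first by rewrite andbT.
  congr (`| _ |); apply: eq_bigr => j _.
  by rewrite /s; case: cid => ? /= ->.
rewrite -lee_fin Kint ge0_integral_sum// big_enum_cond /= -sumEFin.
by under eq_bigl do rewrite andbT; apply: lee_sum => q _; exact: hT.
Qed.

(** Both signs give the norm of [v], so the type inequality for this single vector reads |v| <= T
    |v|. *)
Lemma type_constant_ge1 (R : realType) (X : normedModType R) (p T : R) (v : X) :
  0 < p -> type_constant X p T -> v != 0 -> 1 <= T.
Proof.
move=> p0 hT v0.
have := @type_constant_sign_invariant R X p T 'I_1 predT 1 (fun _ _ => v) `|v| hT.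
rewrite !big_ord1 -powRrM mulfV ?gt_eqF// powRr1// ler_pMl ?normr_gt0//.
by apply=> s; rewrite !big_ord1 normrZ normrX normrN1 expr1n mul1r.
Qed.

Lemma sum_norm_tuple_diff_le (R : realType) (X : normedModType R) (p T : R)
    (I : finType) (f : I -> X) (A : {set I}) (r : nat) (d : R) :
  0 < p -> 0 <= T -> type_constant X p T -> 0 <= d ->
  {in A &, forall a b, `|f a - f b| <= d} ->
  \sum_(y : {ffun 'I_r -> I} | y \in ffun_on A)
    \sum_(z : {ffun 'I_r -> I} | z \in ffun_on A)
     `|\sum_(j < r) (f (y j) - f (z j))|
  <= (#|A| ^ r)%:R * ((#|A| ^ r)%:R * (T * (d * r%:R `^ p^-1))).
Proof.
move=> p0 T0 hT d0 fd; rewrite pair_big /=.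
pose Q (q : {ffun 'I_r -> I} * {ffun 'I_r -> I}) :=
  (q.1 \in ffun_on A) && (q.2 \in ffun_on A).
have := @type_constant_sign_invariant R X p T _ Q r
  (fun q j => f (q.1 j) - f (q.2 j)) _ hT (sum_norm_sign_swap _ _ _ f A r).
move/le_trans; apply; set b := T * _.
apply: (@le_trans _ _ (\sum_(q | Q q) b)).
  apply: ler_sum => q /andP[/ffun_onP q1 /ffun_onP q2]; rewrite ler_wpM2l//.
  (* The right side is the l^p norm of [r] copies of [d], which dominates the norms of the [r]
     differences. *)
  have -> : d * r%:R `^ p^-1 = (\sum_(j < r) d `^ p) `^ p^-1.
    rewrite sumr_const card_ord -(mulr_natr (d `^ p)) powRM ?powR_ge0//.
    by rewrite -powRrM mulfV ?gt_eqF// powRr1.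
  apply: ge0_ler_powR; rewrite ?invr_ge0 ?nnegrE ?(ltW p0)//.
  - by apply: sumr_ge0 => j _; exact: powR_ge0.
  - by apply: sumr_ge0 => j _; exact: powR_ge0.
  apply: ler_sum => j _; apply: ge0_ler_powR; rewrite ?nnegrE ?(ltW p0)//.
  exact: fd.
rewrite sumr_const.
have -> : #|Q| = ((#|A| ^ r) * (#|A| ^ r))%N.
  have cS : #|[pred y : {ffun 'I_r -> I} | y \in ffun_on A]| = (#|A| ^ r)%N.
    by rewrite -[in RHS](card_ord r) -card_ffun_on; apply: eq_card.
  by rewrite -cS -cardX; apply: eq_card => -[y z]; rewrite !inE.
by rewrite -(mulr_natl b) natrM mulrA.
Qed.

(** * Averaging and Markov's inequality *)

Lemma exists_tuple_half_close (R : realType) (X : normedModType R) (p T : R)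
    (I : finType) (f : I -> X) (A : {set I}) (r : nat) (d : R) :
  (0 < #|A|)%N ->
  0 < p -> 0 < T -> type_constant X p T -> 0 < d -> (0 < r)%N ->
  {in A &, forall a b, `|f a - f b| <= d} ->
  exists z : {ffun 'I_r -> I},
  (#|A| ^ r <= 2 * #|[set y : {ffun 'I_r -> I} | (y \in ffun_on A) &&
     (`|\sum_(j < r) f (y j) - \sum_(j < r) f (z j)|
       <= 4 * (T * (d * r%:R `^ p^-1)))%R]%SET|)%N.
Proof.
move=> A0 p0 T0 hT d0 r0 fd.
set b := T * _.
have b0 : 0 < b by rewrite !mulr_gt0// powR_gt0// ltr0n.
pose h (y z : {ffun 'I_r -> I}) := `|\sum_(j < r) f (y j) - \sum_(j < r) f (z j)|.
have cS : #|[pred y : {ffun 'I_r -> I} | y \in ffun_on A]| = (#|A| ^ r)%N.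
  by rewrite -[in RHS](card_ord r) -card_ffun_on; apply: eq_card.
set N := (#|A| ^ r)%N in cS *.
have N0 : (0 < N)%N by rewrite expn_gt0 A0.
have hle := sum_norm_tuple_diff_le _ X p T _ f A r d p0 (ltW T0) hT (ltW d0) fd.
(* Some [z] is no worse than average; otherwise the double sum would exceed its bound. *)
have [z zA hz] : exists2 z : {ffun 'I_r -> I}, z \in ffun_on A &
    \sum_(y : {ffun 'I_r -> I} | y \in ffun_on A) h y z <= N%:R * b.
  apply: contrapT => nz.
  suff : \sum_(z : {ffun 'I_r -> I} | z \in ffun_on A) N%:R * b <
      \sum_(z : {ffun 'I_r -> I} | z \in ffun_on A)
         \sum_(y : {ffun 'I_r -> I} | y \in ffun_on A) h y z.
    rewrite sumr_const cS -(mulr_natl (N%:R * b)) ltNge exchange_big /=.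
    move=> /negP; apply; apply: le_trans hle.
    by do 2 (apply: ler_sum => ? _); rewrite /h sumrB.
  apply: ltr_sum => [|z zA].
    have /card_gt0P[z zA] : (0 < #|[pred y : {ffun 'I_r -> I} | y \in ffun_on A]|)%N.
      by rewrite cS.
    by apply/hasP; exists z; rewrite ?mem_index_enum.
  by rewrite ltNge; apply/negP => hz; apply: nz; exists z.
exists z; set G := [set y | _]%SET.
have hG : (#|G| + #|[set y : {ffun 'I_r -> I} | (y \in ffun_on A) &&
    ~~ (h y z <= 4 * b)%R]%SET| = N)%N.
  have := cardID (mem G) [pred y : {ffun 'I_r -> I} | y \in ffun_on A].
  rewrite cS => <-; congr (_ + _)%N.
    by apply: eq_card => y; rewrite !inE andbA andbb.
  by apply: eq_card => y; rewrite !inE negb_and andb_orl andNb /= andbC.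
set H := [set y | _]%SET in hG.
(* Markov: each tuple in [H] contributes more than 4b to a sum of at most N b, so 4|H| <= N, which
   is more than enough. *)
have : 4 * b * #|H|%:R <= N%:R * b.
  apply: le_trans hz; rewrite mulr_natr -sumr_const.
  apply: (@le_trans _ _ (\sum_(y in H) h y z)).
    by apply: ler_sum => y; rewrite inE -ltNge => /andP[_ /ltW].
  rewrite big_mkcond [leRHS]big_mkcond /=; apply: ler_sum => y _.
  case: ifPn => [|_]; first by rewrite inE => /andP[-> _].
  by case: ifP => // _; exact: normr_ge0.
rewrite mulrAC ler_pM2r// -natrM ler_nat => hH.
lia.
Qed.

(** * Maximal disjoint families *)

Lemma exists_maximal_disjoint (J T : finType) (G : J -> {set T}) :
  (forall i, G i != finset.set0) ->
  exists M : {set J},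
    (\sum_(i in M) #|G i| <= #|T|)%N /\
    forall i, exists2 k, k \in M & G i :&: G k != finset.set0.
Proof.
move=> G0.
pose dis (M : {set J}) := [forall i in M, forall k in M,
  (i != k) ==> (G i :&: G k == finset.set0)].
have disP (M : {set J}) :
    reflect {in M &, forall i k, i != k -> G i :&: G k = finset.set0} (dis M).
  apply: (iffP forall_inP) => [h i k iM kM ik|h i iM].
    by have /forall_inP/(_ k kM)/implyP/(_ ik)/eqP := h i iM.
  by apply/forall_inP => k kM; apply/implyP => ik; rewrite h.
have : exists M : {set J}, dis M by exists finset.set0; apply/disP => i k; rewrite inE.
move=> /ex_maxset[M /maxsetP[/disP disM maxM]]; exists M; split.
  (* Double counting: by disjointness each point of [T] lies in at most one [G i] with [i] in
     [M]. *)
  under eq_bigr => i _ do rewrite -sum1_card big_mkcond /=.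
  rewrite exchange_big /= -sum1_card; apply: leq_sum => x _.
  rewrite -big_mkcondr /= sum1dep_card.
  apply/card_le1_eqP => i k; rewrite !inE => /andP[iM xi] /andP[kM xk].
  apply/eqP; apply: contraT => ki.
  by have /setP/(_ x) := disM _ _ kM iM ki; rewrite !inE xi xk.
move=> i; apply: contrapT => nk.
have nGk k : k \in M -> G i :&: G k = finset.set0.
  by move=> kM; apply/eqP; apply: contraT => ik; case: nk; exists k.
(* Adding [i] keeps the family disjoint, so maximality puts [i] in [M]; then [G i] misses itself,
   although it is nonempty. *)
have iM : i \in M.
  rewrite -(maxM (i |: M)) ?setU11 ?finset.subsetUr//.
  apply/disP => a b; rewrite !inE => /predU1P[->|aM] /predU1P[->|bM].
  - by rewrite eqxx.
  - by rewrite nGk.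
  - by rewrite finset.setIC nGk.
  - exact: disM.
by apply/negP: (G0 i); rewrite negbK -(finset.setIid (G i)) nGk.
Qed.

(** * Averages in convex hulls, and the diameter *)

(** By induction: the mean of n+2 points combines the mean of the first n+1, with weight
    (n+1)/(n+2), and the last point. *)
Lemma convex_hull_mean (R : realType) (X : lmodType R) (B : set X) (n : nat)
    (x : nat -> X) :
  (forall j, B (x j)) -> convex_hull B (n.+1%:R^-1 *: \sum_(j < n.+1) x j).
Proof.
move=> xB C [cC BC]; elim: n => [|n IHn].
  by rewrite big_ord1 invr1 scale1r; exact: BC.
have t1 : 0 <= (n.+1%:R / n.+2%:R : R) <= 1.
  by rewrite divr_ge0//= ler_pdivrMr ?ltr0n// mul1r ler_nat.
have [k kE] : exists k : {i01 R}, k%:num = n.+1%:R / n.+2%:R.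
  by exists (Itv01 (andP t1).1 (andP t1).2).
have /set_mem := cC _ _ k (mem_set IHn) (mem_set (BC _ (xB n.+1))).
congr (C _); rewrite [LHS]/(_ *: _ + _ *: _) kE.
rewrite scalerA mulrAC mulfV ?pnatr_eq0// mul1r [in RHS]big_ord_recr /= scalerDr.
congr (_ + _ *: _).
rewrite /unstable.onem -[X in X - _](@mulfV _ n.+2%:R) ?pnatr_eq0// -mulrBl.
by rewrite -natr1 addrAC subrr add0r mul1r.
Qed.

(** [sup] is an upper bound once the distances are bounded, and twice the sum of the norms over [P]
    bounds them. *)
Lemma ler_norm_diam (R : realType) (X : normedModType R) (P : {fset X}) (x y : X) :
  x \in P -> y \in P -> `|x - y| <= diam [set` P].
Proof.
move=> xP yP; apply: ub_le_sup; last by exists x => //; exists y.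
have le_sum a : a \in P -> `|a| <= \sum_(b : P) `|val b|.
  move=> aP; rewrite (bigD1 [` aP]%fset)//= lerDl.
  by apply: sumr_ge0 => ? _.
exists (\sum_(b : P) `|val b| + \sum_(b : P) `|val b|) => _ [a aP [b bP <-]].
by rewrite (le_trans (ler_normB _ _))// lerD// le_sum.
Qed.

(** * Degenerate cases, then the construction of [F] *)

Theorem theorem3 (R : realType) (X : completeNormedModType R) (p T : R)
    (hp1 : 1 < p) (hp2 : p <= 2) (hT : type_constant X p T)
    (P : {fset X}) (n : nat) (hn : #|` P| = n)
    (r : nat) (hr1 : (1 <= r)%N) (hrn : (r <= n)%N) (eps : R) (heps : 0 < eps) :
  let w : R := (1 - p) / p in
  let C : R := 2 * (2 `^ p^-1 / (1 - 2 `^ w)) * T in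
  let D : R := diam [set` P] in
  exists F : {fset X},
    #|` F|%:R <= r%:R ^+ r * eps ^- r /\
    forall Y : {fset X}, (Y `<=` P)%fset -> eps * n%:R <= #|` Y|%:R ->
      minkowski_sum [set` F] (cball 0 (C * r%:R `^ w * D)) `&` convex_hull [set` Y]
        !=set0.
Proof.
move=> w C D.
have p0 : 0 < p by rewrite (lt_trans ltr01).
have n0 : (0 < n)%N by exact: leq_trans hrn.
have rhs0 : 0 <= r%:R ^+ r * eps ^- r.
  by rewrite mulr_ge0 ?invr_ge0 ?exprn_ge0 ?(ltW heps).
have hD x y : x \in P -> y \in P -> `|x - y| <= D by exact: ler_norm_diam.
(* For [eps] > 1 no [Y] is large enough, so the empty set works. *)
have [eps1|eps1] := ltP 1 eps.
  exists fset0; split=> [|Y YP]; first by rewrite cardfs0.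
  have : (#|` Y| <= n)%N by rewrite -hn fsubset_leq_card.
  rewrite -(ler_nat R) => /[swap] /le_trans/[apply].
  by rewrite ger_pMl ?ltr0n// leNgt eps1.
have [x0 x0P] : exists x, x \in P by apply/fset0Pn; rewrite -cardfs_gt0 hn.
have D0 : 0 <= D by rewrite (le_trans _ (hD _ _ x0P x0P)).
set rho := C * _ * D.
have Yne (Y : {fset X}) : eps * n%:R <= #|` Y|%:R -> (0 < #|` Y|)%N.
  by rewrite -(ltr0n R); apply: lt_le_trans; rewrite mulr_gt0// ltr0n.
(* A ball of radius at least [D] around any point of [P] covers [P], and one point is allowed since
   [eps] <= 1. *)
have [Drho|] := leP D rho.
  exists [fset x0]%fset; split.
    rewrite cardfs1 -[1%:R]mulr1; apply: ler_pM => //.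
      by rewrite exprn_ege1// ler1n.
    by rewrite invf_ge1 ?exprn_gt0// exprn_ile1// ltW.
  move=> Y YP /Yne; rewrite cardfs_gt0 => /fset0Pn[y yY].
  exists y; split; last by move=> A [_]; apply.
  exists x0; first by rewrite /= inE.
  exists (y - x0); last by rewrite addrC subrK.
  rewrite /cball /closed_ball_ /= sub0r opprB (le_trans _ Drho)// hD//.
  exact: (fsubsetP YP).
have [D_gt0|] := ltP 0 D; last first.
  move=> D_le0; have D_eq0 : D = 0 by apply/eqP; rewrite eq_le D_le0.
  by rewrite /rho D_eq0 mulr0 ltxx.
(* As [D] > 0, two points of [P] differ, and their difference is a nonzero vector. *)
have T1 : 1 <= T.
  have [[x [y [xP yP xy]]]|xy] := pselect (exists x y, [/\ x \in P, y \in P & x != y]).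
    by apply: (type_constant_ge1 _ _ _ _ (x - y) p0 hT); rewrite subr_eq0.
  suff : D <= 0 by rewrite leNgt D_gt0.
  apply: ge_sup => [|_ [x xP [y yP <-]]].
    by exists `|x0 - x0|, x0 => //; exists x0.
  rewrite normr_le0 subr_eq0; apply: contraT => nxy.
  by case: xy; exists x, y.
have T0 : 0 < T by rewrite (lt_le_trans ltr01).
have w0 : w < 0 by rewrite /w pmulr_llt0 ?invr_gt0// subr_lt0.
(* Since -1 <= w < 0, the factor 1 - 2^w lies in (0, 1/2], so its inverse is at least 2; also
   2^(1/p) >= 1. *)
have C4T : 4 * T <= C.
  rewrite /C ler_pM2r//.
  have h1 : 1 <= 2 `^ p^-1 :> R.
    by rewrite -[leLHS](powRr0 2) ler_powR ?ler1n// invr_ge0 ltW.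
  have wge : -1 <= w.
    by rewrite /w ler_pdivlMr//; lra.
  have h2 : 2^-1 <= 2 `^ w :> R.
    by rewrite -powR_inv1// ler_powR// ler1n.
  have h3 : 2 `^ w < 1 :> R.
    rewrite lt_neqAle powR_eq1 !negb_or pnatr_eq1 -leNgt ler0n (lt_eqF w0) /=.
    by rewrite -[leRHS](powRr0 2) ler_powR ?ler1n// ltW.
  have : 2 <= (1 - 2 `^ w)^-1 :> R.
    by rewrite -[leLHS]invrK lef_pV2 ?posrE ?invr_gt0 ?subr_gt0//; lra.
  set c := (1 - _)^-1 => c2.
  nra.
move=> rhoD.
(* For r = 1 the radius C D would be at least [D], a case already settled. *)
have r2 : (2 <= r)%N.
  rewrite ltn_neqAle hr1 andbT; apply: contraL rhoD => /eqP r1.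
  by rewrite -leNgt /rho -r1 powR1 mulr1 ler_peMl//; lra.
have r0 : (0 < r)%N by [].
pose J := {A : {set P} | eps * n%:R <= #|A|%:R}.
pose b := 4 * (T * (D * r%:R `^ p^-1)).
have J0 (A : J) : (0 < #|val A|)%N.
  by rewrite -(ltr0n R); apply: lt_le_trans (valP A); rewrite mulr_gt0// ltr0n.
pose good (A : J) (zA : {ffun 'I_r -> P}) := [set y : {ffun 'I_r -> P} |
  (y \in ffun_on (val A)) &&
  (`|\sum_(j < r) val (y j) - \sum_(j < r) val (zA j)| <= b)]%SET.
have exz (A : J) : exists zA, (#|val A| ^ r <= 2 * #|good A zA|)%N.
  apply: (exists_tuple_half_close _ _ _ _ _ (fun x : P => val x)
    _ _ _ (J0 A) p0 T0 hT D_gt0 r0).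
  by move=> x y _ _; exact: hD (valP x) (valP y).
have [z zP] := boolp.choice exz.
pose G (A : J) := good A (z A).
have cardP : #|{: P}| = n by rewrite -hn cardfE.
have G_neq0 A : G A != finset.set0.
  rewrite -card_gt0; have := leq_trans _ (zP A).
  by move/(_ 1%N); rewrite expn_gt0 J0 muln_gt0 => /(_ isT).
have [M [Mle cov]] := exists_maximal_disjoint _ _ _ G_neq0.
pose c (A : J) : X := r%:R^-1 *: \sum_(j < r) val (z A j).
exists [fset c A | A in M]%fset; split.
  apply: (@le_trans _ _ (#|M|%:R)).
    by rewrite ler_nat (leq_trans (leq_imfset_card _ _ _)) ?cardE.
  rewrite ler_pdivlMr ?exprn_gt0//.
  (* The bound |M| eps^r <= 2 comes from |M| (eps n)^r <= sum of |A|^r <= 2 sum of |G A| <= 2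
     n^r. *)
  apply: (@le_trans _ _ 2); last first.
    rewrite (@le_trans _ _ (2 ^+ r))//; last by rewrite lerXn2r ?nnegrE// ler_nat.
    by rewrite -[leLHS]expr1 ler_eXn2l// ltr1n.
  have : (\sum_(A in M) #|val A| ^ r <= 2 * n ^ r)%N.
    have -> : (n ^ r = #|{ffun 'I_r -> P}|)%N by rewrite card_ffun card_ord cardP.
    apply: leq_trans (_ : 2 * \sum_(A in M) #|G A| <= _)%N; last by rewrite leq_mul2l.
    by rewrite big_distrr leq_sum.
  rewrite -(ler_nat R) natr_sum natrM natrX => le2n.
  have nr0 : 0 < (n%:R ^+ r : R) by rewrite exprn_gt0 ?ltr0n.
  rewrite -(ler_pM2r nr0); apply: le_trans le2n.
  rewrite -mulrA -exprMn mulr_natl -sumr_const; apply: ler_sum => A _.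
  by rewrite natrX lerXn2r ?nnegrE ?mulr_ge0 ?(ltW heps)//; exact: valP A.
move=> Y YP Yn.
pose A0 := [set x : P | val x \in Y]%SET.
have A0Y : #|A0| = #|` Y|.
  have -> : Y = [fset val x | x in A0]%fset.
    apply/fsetP => y; apply/idP/imfsetP => [yY|[x /=]]; last by rewrite inE => ? ->.
    by exists [` fsubsetP YP y yY]%fset; rewrite ?inE.
  rewrite card_imfset /=; first by rewrite cardE.
  exact: val_inj.
have A0n : eps * n%:R <= #|A0|%:R by rewrite A0Y.
(* The tuple [y] is good for both [Y] and [B]: its entries lie in [Y], and its average is within b/r
   of [c B]. *)
have [B BM /set0Pn[y]] := cov (exist _ A0 A0n).
rewrite !inE /= => /andP[/andP[/ffun_onP yY _] /andP[_ yB]].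
exists (r%:R^-1 *: \sum_(j < r) val (y j)); split.
  exists (c B); first by apply/imfsetP; exists B.
  exists (r%:R^-1 *: \sum_(j < r) val (y j) - c B); last by rewrite addrC subrK.
  rewrite /cball /closed_ball_ /= sub0r normrN -scalerBr normrZ.
  rewrite ger0_norm ?invr_ge0//.
  apply: (@le_trans _ _ (r%:R^-1 * b)); first by rewrite ler_wpM2l ?invr_ge0.
  have rw : r%:R `^ w = r%:R^-1 * r%:R `^ p^-1.
    rewrite /w mulrBl mul1r mulfV ?gt_eqF// powRB; last first.
      by apply/implyP => _; rewrite pnatr_eq0 gtn_eqF.
    by rewrite powRr1// mulrC.
  rewrite /b /rho rw.
  have -> : r%:R^-1 * (4 * (T * (D * r%:R `^ p^-1))) =
      (4 * T) * (r%:R^-1 * r%:R `^ p^-1) * D.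
    by ring.
  by do 2!apply: ler_wpM2r => //.
(* The lemma on means wants a successor and a sequence indexed by [nat], hence [inord]. *)
case: r r0 y yY {hr1 hrn rhs0 rho rhoD r2 b good exz z zP G G_neq0
  Mle cov yB c BM B M} => // r _ y yY.
have -> : \sum_(j < r.+1) val (y j) = \sum_(j < r.+1) val (y (inord j)).
  by apply: eq_bigr => j _; rewrite inord_val.
apply: (convex_hull_mean _ _ _ r (fun j => val (y (inord j)))) => j.
by have := yY (inord j); rewrite inE.
Qed.
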